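(* Let $d\ge 3$ be an integer. For $\alpha\in\mathbb{R}\setminus\mathbb{Q}$ and a function $\varepsilon\colon\mathbb{N}\to(0,\infty)$ set $$\mathcal{A}_\varepsilon^\alpha=\{n\in\mathbb{N} : \|\alpha n^d\|_{\mathbb{R}/\mathbb{Z}}\le\varepsilon(n)\}.$$ Then the following hold. (B1) For all $\alpha \in \mathbb{R}\setminus\mathbb{Q}$ outside a set of Lebesgue measure $0$, there exists $\varepsilon_\alpha\colon\mathbb{N}\to(0,\infty)$ with $\varepsilon_\alpha(n)\to 0$ as $n\to\infty$ such that, whenever $\varepsilon(n)\ge\varepsilon_\alpha(n)$ for all $n$, the set $\mathcal{A}_\varepsilon^\alpha$ is a basis of order $2$. (B2) There exist a constant $\varepsilon_0>0$ and uncountably many $\alpha\in\mathbb{R}\setminus\mathbb{Q}$ such that, for the constant function $\varepsilon(n)=\varepsilon_0$, the set $\mathcal{A}_\varepsilon^\alpha$ is not a basis of order $2$.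
   Context: $\mathbb{N}=\{0,1,2,\dots\}$ and $\|t\|_{\mathbb{R}/\mathbb{Z}}=\min_{n\in\mathbb{Z}}|t-n|$. A set $\mathcal{A}\subset\mathbb{N}$ is a basis of order $2$ if $2\mathcal{A}=\{n_1+n_2 : n_1,n_2\in\mathcal{A}\}$ contains all sufficiently large integers. *)

(* Defs.v *)
From HB Require Import structures.
From mathcomp Require Import all_boot all_order all_algebra.
From mathcomp Require Import all_classical all_reals all_analysis.
From mathcomp Require Import lra.

Set Implicit Arguments.
Unset Strict Implicit.
Unset Printing Implicit Defensive.

Import Order.TTheory GRing.Theory Num.Theory.
Import numFieldNormedType.Exports.

Local Open Scope classical_set_scope.
Local Open Scope ring_scope.

(* The infimum is a minimum: see [dist_intP]. *)
Definition dist_int (R : realType) (t : R) : R :=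
  inf [set `|t - n%:~R| | n in [set: int]].

Lemma dist_intP (R : realType) (t : R) :
  (exists n : int, dist_int t = `|t - n%:~R|) /\
  (forall n : int, dist_int t <= `|t - n%:~R|).
Proof.
set S := [set `|t - n%:~R| | n in [set: int]].
have hlb : has_lbound S by exists 0 => _ [n _ <-]; exact: normr_ge0.
have S0 : S !=set0 by exists `|t - 0%:~R|, 0.
split; last by move=> n; apply: ge_inf => //; exists n.
have f0 : (Num.floor t)%:~R <= t := floor_le t.
have f1 : t < (Num.floor t)%:~R + 1 by have := floorD1_gt t; rewrite intrD.
pose m := Num.min (t - (Num.floor t)%:~R) ((Num.floor t)%:~R + 1 - t).
have lem (n : int) : m <= `|t - n%:~R|.
  have [nt|tn] := leP n (Num.floor t).
    have {}nt : n%:~R <= (Num.floor t)%:~R :> R by rewrite ler_int.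
    rewrite ge_min; apply/orP; left; apply: le_trans (ler_norm _); lra.
  have {}tn : (Num.floor t)%:~R + 1 <= n%:~R :> R.
    by rewrite -[1]/(1%:~R) -intrD ler_int lezD1.
  rewrite ge_min; apply/orP; right; rewrite distrC.
  apply: le_trans (ler_norm _); lra.
have [n mE] : exists n : int, m = `|t - n%:~R|.
  rewrite /m; case: leP => _.
    by exists (Num.floor t); rewrite ger0_norm // subr_ge0.
  exists (Num.floor t + 1); rewrite distrC intrD ger0_norm //.
  by rewrite subr_ge0 ltW.
exists n; apply/le_anti/andP; split; first by apply: ge_inf => //; exists n.
by rewrite -mE; apply: lb_le_inf => // _ [k _ <-]; exact: lem.
Qed.

Definition sumset2 (A : set nat) : set nat :=
  [set (n1 + n2)%N | n1 in A & n2 in A].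

Definition basis_order2 (A : set nat) : Prop :=
  \forall n \near \oo, sumset2 A n.

Definition small_frac_set (R : realType) (d : nat) (alpha : R)
    (eps : nat -> R) : set nat :=
  [set n | dist_int (alpha * n%:R ^+ d) <= eps n].

(* Main.v *)
Require Import Defs.
From mathcomp Require Import all_boot all_order all_algebra.
From mathcomp Require Import all_classical all_reals all_analysis.
From mathcomp Require Import measurable_realfun.
From mathcomp Require Import zify ring lra.

Import Order.TTheory GRing.Theory Num.Theory.
Import numFieldNormedType.Exports.

Local Open Scope classical_set_scope.
Local Open Scope ring_scope.

(* (B1) Let [x, y] be [a n ^ d, a (N - n) ^ d]. The kernel
   [cos (pi x) ^ 2M * cos (pi y) ^ 2M] is exponentially small in [M] unless both
   [x] and [y] are close to integers, while its mean over the torus is at least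
   [1 / (2M + 1) ^ 2]. So [N] is represented as soon as the finitely many sums
   over [n <= N] of [cos (2 pi a (k n ^ d + l (N - n) ^ d))], [(k, l) <> (0, 0)],
   are small compared with [N]. The fourth moment in [a] of such a sum counts the
   solutions of [P n1 - P n2 = P n3 - P n4], where [P] has degree at least [2]
   because [d >= 3]. As [n1 - n2] divides [P n1 - P n2] and
   [P (X + h) - P X] is not constant for [h <> 0], the divisor bound gives
   [O (N ^ (5/2))] solutions; hence the sum exceeds [eta N] with probability
   [O (N ^ (- 3/2))], and Borel-Cantelli settles almost every [a].

   (B2) If [N = x + y] is odd then [x ^ d - (- y) ^ d = N K] with [K] odd. When
   [a] is within [1 / (16 N ^ d)] of [b / 2N] with [b] odd,
   [a (x ^ d - (- y) ^ d)] is therefore close to a half-integer, so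
   [a x ^ d] and [a y ^ d] are not both within [1/8] of integers. By Baire's theorem
   the [a] having such approximations for arbitrarily large [N] form an
   uncountable set. *)

(** * Counting by fibres and the divisor bound *)

Lemma leq_expn2r (a m n : nat) : (m <= n)%N -> (m ^ a <= n ^ a)%N.
Proof. by case: a => [|a] mn; rewrite ?expn0 // leq_exp2r. Qed.

Lemma card_le_fiber (T : finType) (U : eqType) (f : T -> U) (s : seq U)
    (S : {set T}) (c : nat) :
  (forall x, x \in S -> f x \in s) ->
  (forall u, u \in s -> (#|[set x in S | f x == u]| <= c)%N) ->
  (#|S| <= c * size s)%N.
Proof.
elim: s S => [|u s IHs] S fS cS.
  rewrite muln0 leqn0 cards_eq0; apply/eqP/setP => x; rewrite inE.
  by apply/negP => /fS; rewrite in_nil.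
rewrite -(cardsID [set x | f x == u] S) mulnS leq_add //.
  apply: leq_trans (cS u (mem_head _ _)); apply: subset_leq_card.
  by apply/fintype.subsetP => x; rewrite !inE.
apply: IHs => [x|v vs].
  by rewrite !inE => /andP[xu /fS]; rewrite inE (negbTE xu).
apply: leq_trans (cS v _); last by rewrite inE vs orbT.
apply: subset_leq_card; apply/fintype.subsetP => x; rewrite !inE.
by case/andP => /andP[_ ->] ->.
Qed.

Lemma size_divisors_mul_pfactor (p a m : nat) : prime p -> (0 < m)%N ->
  coprime p m -> (size (divisors (m * p ^ a)) <= size (divisors m) * a.+1)%N.
Proof.
move=> p_pr m_gt0 cpm; have p_gt0 := prime_gt0 p_pr.
have n_gt0 : (0 < m * p ^ a)%N by rewrite muln_gt0 m_gt0 expn_gt0 p_gt0.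
pose t := [seq (x * p ^ i)%N | x <- divisors m, i <- iota 0 a.+1].
have -> : (size (divisors m) * a.+1)%N = size t by rewrite size_allpairs size_iota.
apply: uniq_leq_size (divisors_uniq _) _ => x; rewrite -dvdn_divisors // => xn.
have x_gt0 : (0 < x)%N := dvdn_gt0 n_gt0 xn.
have [y cpy xE] := pfactor_coprime p_pr x_gt0.
apply/allpairsP; exists (y, logn p x); split; [|rewrite mem_iota|exact: xE].
  rewrite /= -dvdn_divisors // -(@Gauss_dvdl _ _ (p ^ a)%N); last first.
    by rewrite coprimeXr // coprime_sym.
  by apply: dvdn_trans xn; rewrite xE dvdn_mulr.
rewrite ltnS /= (leq_trans (dvdn_leq_log p n_gt0 xn)) //.
by rewrite lognM ?expn_gt0 ?p_gt0 // logn_coprime // pfactorK.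
Qed.

(** With [q] the quotient of [a] by [k], [a + 1 <= k (q + 1) <= k 2 ^ q]; take [k]-th powers and use
    [q k <= a]. *)
Lemma expS_le_exp2 (k a : nat) : (0 < k)%N -> (a.+1 ^ k <= k ^ k * 2 ^ a)%N.
Proof.
move=> k_gt0; have aE := divn_eq a k; set q := (a %/ k)%N in aE.
have h1 : (a.+1 <= k * 2 ^ q)%N.
  apply: (@leq_trans (q.+1 * k)%N); first by rewrite mulSn {1}aE addnC ltn_add2r ltn_pmod.
  by rewrite mulnC leq_mul2l ltn_expl // orbT.
rewrite -(leq_exp2r _ _ k_gt0) in h1; apply: leq_trans h1 _.
rewrite expnMn leq_mul2l -expnM leq_pexp2l ?orbT //.
by rewrite aE leq_addr.
Qed.

(* Primes above [2 ^ k] cost nothing, since [(a + 1) ^ k <= (2 ^ k) ^ a <= p ^ a];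
   each of the finitely many smaller ones costs a bounded factor. *)
Lemma divisor_bound (k : nat) : (0 < k)%N -> exists2 C : nat, (0 < C)%N &
  forall n, (0 < n)%N -> (size (divisors n) ^ k <= C * n)%N.
Proof.
move=> k_gt0.
pose rough B n := forall p, prime p -> (p %| n)%N -> (B <= p)%N.
have strip p n : prime p -> (0 < n)%N -> exists m a, [/\ n = (m * p ^ a)%N,
    (0 < m)%N, coprime p m, (p %| n -> m < n)%N &
    (size (divisors n) ^ k <= size (divisors m) ^ k * a.+1 ^ k)%N].
  move=> p_pr n_gt0; have [m cpm nE] := pfactor_coprime p_pr n_gt0.
  have m_gt0 : (0 < m)%N by move: n_gt0; rewrite nE; case: (m).
  exists m, (logn p n); split => //.
    move=> pn; rewrite nE ltn_Pmulr // -{1}(expn0 p) ltn_exp2l ?prime_gt1 //.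
    by rewrite logn_gt0 mem_primes p_pr n_gt0.
  by rewrite -expnMn leq_exp2r // {1}nE size_divisors_mul_pfactor.
have large n : (0 < n)%N -> rough (2 ^ k)%N n -> (size (divisors n) ^ k <= n)%N.
  elim/ltn_ind: n => n IHn n_gt0 nr.
  have [n_le1|n_gt1] := leqP n 1; first by rewrite (_ : n = 1%N) ?exp1n //; lia.
  have p_pr := pdiv_prime n_gt1; have pn := pdiv_dvd n.
  have [m [a [nE m_gt0 cpm mn bound]]] := strip _ n p_pr n_gt0.
  apply: leq_trans bound _; rewrite nE leq_mul //.
    apply: IHn; rewrite ?mn // => p p_p pm; apply: nr => //.
    by apply: dvdn_trans pm _; rewrite nE dvdn_mulr.
  have := ltn_expl a (isT : 1 < 2)%N; rewrite -(leq_exp2r _ _ k_gt0) => /leq_trans; apply.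
  by rewrite -expnM mulnC expnM leq_expn2r // nr.
(* Induction on [i] lowers the bound [B] on the prime divisors from [2 ^ k] to [0]; each step costs
   a factor [k ^ k], by [expS_le_exp2]. *)
suff small i B : (B + i = 2 ^ k)%N -> exists2 C : nat, (0 < C)%N &
    forall n, (0 < n)%N -> rough B n -> (size (divisors n) ^ k <= C * n)%N.
  have [C C_gt0 HC] := small (2 ^ k)%N 0%N (add0n _).
  by exists C => // n n_gt0; apply: HC.
elim: i B => [|i IHi] B Bi.
  exists 1%N => // n n_gt0; rewrite -[B]addn0 Bi mul1n; exact: large.
have [C C_gt0 HC] := IHi B.+1 ltac:(by rewrite addSnnS).
exists (C * k ^ k)%N; first by rewrite muln_gt0 C_gt0 expn_gt0 k_gt0.
move=> n n_gt0 nr; have [B_pr|B_npr] := boolP (prime B); last first.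
  apply: leq_trans (HC n n_gt0 _) _; last first.
    by rewrite leq_mul2r leq_pmulr ?orbT // expn_gt0 k_gt0.
  move=> p p_pr pn; rewrite ltn_neqAle nr // andbT.
  by apply: contraNneq B_npr => ->.
have [m [a [nE m_gt0 cpm mn bound]]] := strip _ n B_pr n_gt0.
apply: leq_trans bound _.
have mr : rough B.+1 m.
  move=> p p_pr pm; rewrite ltn_neqAle nr // ?andbT.
    apply: contraTneq cpm => ->; rewrite prime_coprime ?negbK //.
  by apply: dvdn_trans pm _; rewrite nE dvdn_mulr.
rewrite nE (_ : C * k ^ k * (m * B ^ a) = (C * m) * (k ^ k * B ^ a))%N; last by ring.
apply: leq_mul; first exact: HC.
apply: leq_trans (expS_le_exp2 _ a k_gt0) _.
by rewrite leq_mul2l leq_expn2r ?orbT // prime_gt1.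
Qed.

(** * Fibres and differences of integer polynomials *)

Lemma card_poly_fiber (p : {poly int}) (N : nat) (v : int) :
  (1 < size p)%N -> (#|[set n : 'I_N | p.[n%:Z] == v]%SET| < size p)%N.
Proof.
move=> p1; have sq : size (p - v%:P) = size p.
  by rewrite size_polyDl // size_polyN (leq_ltn_trans (size_polyC_leq1 v)).
have q0 : p - v%:P != 0 by rewrite -size_poly_gt0 sq; lia.
rewrite -sq cardE -(size_map (fun n : 'I_N => n%:Z)).
apply: max_poly_roots q0 _ _.
  apply/allP => _ /mapP[n + ->]; rewrite mem_enum inE => /eqP pn.
  by rewrite rootE !hornerE pn subrr.
by rewrite map_inj_uniq ?enum_uniq // => m n /= [] /val_inj.
Qed.

Lemma size_poly_shift (p : {poly int}) (h : int) : size (p \Po ('X + h%:P)) = size p.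
Proof. by rewrite size_comp_poly2 // size_XaddC. Qed.

(* If [p (X + h) - p X] were a constant [v], then [p (h X) - v X] would take the
   value [p 0] at every natural number, so [p] would be linear. *)
Lemma size_poly_difference (p : {poly int}) (h : int) : h != 0 ->
  (2 < size p)%N -> (1 < size (p \Po ('X + h%:P) - p)%R)%N.
Proof.
move=> h0 p2; rewrite ltnNge; apply/negP => /size1_polyC.
set v := (_)`_0 => pv.
have step x : p.[x + h] = p.[x] + v.
  have := congr1 (fun q : {poly int} => q.[x]) pv.
  by rewrite !hornerE horner_comp !hornerE => <-; rewrite addrCA subrr addr0.
have pn (n : nat) : p.[h * n%:Z] = p.[0] + v * n%:Z.
  elim: n => [|n IHn]; first by rewrite !mulr0 addr0.
  by rewrite -addn1 PoszD mulrDr mulr1 step IHn; lia.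
pose q := p \Po (h *: 'X).
have sX : size (h *: 'X : {poly int}) = 2%N by rewrite size_scale ?size_polyX.
have sq : size q = size p by rewrite size_comp_poly2.
pose r := q - (v *: 'X).
have sr : size r = size p.
  rewrite size_polyDl ?sq // size_polyN.
  by apply: leq_ltn_trans (size_scale_leq _ _) _; rewrite size_polyX.
(* [r] takes the value [p 0] at [size p] points, one more than its degree allows. *)
have := @card_poly_fiber r (size p) p.[0].
rewrite sr => /(_ (ltnW p2)).
rewrite (_ : [set n | _]%SET = [set: 'I_(size p)]%SET) ?cardsT ?card_ord ?ltnn //.
apply/setP => n; rewrite !inE /r /q !hornerE horner_comp !hornerE pn.
by apply/eqP; lia.
Qed.

Lemma dvdz_horner_sub (p : {poly int}) (m n : int) :
  (m - n %| p.[m] - p.[n])%Z.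
Proof.
have /factor_theorem[q pE] : root (p - p.[n]%:P) n.
  by rewrite rootE !hornerE subrr.
have := congr1 (fun q : {poly int} => q.[m]) pE.
by rewrite !hornerE => ->; rewrite dvdz_mull.
Qed.

(** * Additive energy of the values of a polynomial *)

Definition additive_energy (p : {poly int}) (N : nat) : nat :=
  #|[set y : ('I_N * 'I_N) * ('I_N * 'I_N) |
      (p.[y.1.1%:Z] - p.[y.1.2%:Z])%R == (p.[y.2.1%:Z] - p.[y.2.2%:Z])%R]%SET|.

Section AdditiveEnergy.

Variables (p : {poly int}) (d N T : nat).
Hypotheses (p_gt2 : (2 < size p)%N) (p_le : (size p <= d.+1)%N).
Hypothesis divT : forall m n : 'I_N, p.[m%:Z] != p.[n%:Z] ->
  (size (divisors `|p.[m%:Z] - p.[n%:Z]|%N) <= T)%N.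

Let card_coincidence :
  (#|[set x : 'I_N * 'I_N | p.[x.1%:Z] == p.[x.2%:Z]]%SET| <= d * N)%N.
Proof.
rewrite (_ : d * N = d * size (enum 'I_N))%N; last by rewrite -cardE card_ord.
apply: (@card_le_fiber _ _ snd) => [x _|n _]; first by rewrite mem_enum.
rewrite -(card_in_imset (f := fst)); last first.
  by move=> [a b] [a' b']; rewrite !inE /= => /andP[_ /eqP ->] /andP[_ /eqP ->] ->.
apply: leq_trans (_ : #|[set m : 'I_N | p.[m%:Z] == p.[n%:Z]]%SET| <= _)%N.
  apply: subset_leq_card; apply/fintype.subsetP => m /imsetP[[a b]].
  by rewrite !inE /= => /andP[ab /eqP <-] ->.
by rewrite -ltnS (leq_trans _ p_le) // card_poly_fiber // ltnW.
Qed.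

(** The gap [u = x1 - x2] divides [v], so up to sign it is a divisor of [v]; for each [u], [x2] is a
    root of the nonconstant polynomial [p (X + u) - p X - v]. *)
Let card_difference (v : int) : v != 0 ->
  (#|[set x : 'I_N * 'I_N | (p.[x.1%:Z] - p.[x.2%:Z])%R == v]%SET| <=
     d * (size (divisors `|v|%N)).*2)%N.
Proof.
move=> v0; pose s := [seq m%:Z | m <- divisors `|v|%N] ++
  [seq - m%:Z | m <- divisors `|v|%N].
have v_gt0 : (0 < `|v|)%N by lia.
rewrite -addnn (_ : _ + _ = size s)%N; last by rewrite size_cat !size_map.
pose f (x : 'I_N * 'I_N) := (x.1%:Z - x.2%:Z).
apply: (@card_le_fiber _ _ f) => [x|u].
  rewrite inE => /eqP xv.
  have : (f x %| v)%Z by rewrite -xv dvdz_horner_sub.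
  rewrite dvdzE => fv; rewrite mem_cat.
  have [fx_ge0|fx_lt0] := lerP 0 (f x); apply/orP; [left|right];
    apply/mapP; exists `|f x|%N; rewrite -?dvdn_divisors //.
    by rewrite gez0_abs.
  by rewrite ltz0_abs // opprK.
move=> us.
have u0 : u != 0.
  move: us; rewrite mem_cat => /orP[] /mapP[m + ->];
    rewrite -dvdn_divisors // => /(dvdn_gt0 v_gt0); rewrite ?oppr_eq0 -lt0n; exact: id.
rewrite -(card_in_imset (f := snd)); last first.
  move=> [a b] [a' b']; rewrite !inE /f /= => /andP[_ /eqP ab] /andP[_ /eqP ab'] bb'.
  have [] : a%:Z = a'%:Z by apply: (addIr (- b'%:Z)); rewrite ab' -bb'.
  by move=> /val_inj ->; rewrite bb'.
pose q := p \Po ('X + u%:P) - p.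
apply: leq_trans (_ : #|[set m : 'I_N | q.[m%:Z] == v]%SET| <= _)%N.
  apply: subset_leq_card; apply/fintype.subsetP => m /imsetP[[a b]].
  rewrite !inE /f /= => /andP[/eqP <- /eqP fu] ->.
  by rewrite /q !hornerE horner_comp !hornerE -fu addrCA subrr addr0.
rewrite -ltnS; apply: leq_trans (card_poly_fiber _ _ _ _) _.
  exact: size_poly_difference.
by apply: leq_trans (size_polyD _ _) _; rewrite size_polyN size_poly_shift maxnn.
Qed.

(** Quadruples with both differences zero are pairs of coincidences. In any other, the second pair
    has a nonzero difference and leaves at most [2 d T] first pairs. *)
Lemma additive_energy_le :
  (additive_energy p N <= (d * N) ^ 2 + d * T.*2 * N ^ 2)%N.
Proof.
pose Z := [set y : ('I_N * 'I_N) * ('I_N * 'I_N) | p.[y.2.1%:Z] == p.[y.2.2%:Z]]%SET.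
rewrite /additive_energy -(cardsID Z) leq_add //.
  pose D := [set x : 'I_N * 'I_N | p.[x.1%:Z] == p.[x.2%:Z]]%SET.
  apply: leq_trans (_ : #|finset.setX D D| <= _)%N.
    apply: subset_leq_card; apply/fintype.subsetP => -[x y]; rewrite !inE /=.
    by case/andP => + /eqP yy; rewrite yy subrr subr_eq0 => ->; rewrite eqxx.
  by rewrite cardsX -mulnn leq_mul.
have -> : (N ^ 2 = size (enum {: 'I_N * 'I_N}))%N.
  by rewrite -cardE card_prod card_ord mulnn.
apply: (@card_le_fiber _ _ snd) => [x _|y _]; first by rewrite mem_enum.
have [yy|yy] := eqVneq p.[y.1%:Z] p.[y.2%:Z].
  rewrite (_ : [set _ in _ | _]%SET = finset.set0) ?cards0 //.
  apply/setP => -[x z]; rewrite !inE /=; apply/negP => /andP[/andP[zz _] /eqP zy].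
  by move: zz; rewrite zy yy eqxx.
rewrite -(card_in_imset (f := fst)); last first.
  by move=> [a b] [a' b']; rewrite !inE /= => /andP[_ /eqP ->] /andP[_ /eqP ->] ->.
apply: leq_trans (leq_trans (card_difference (p.[y.1%:Z] - p.[y.2%:Z]) _) _).
- apply: subset_leq_card; apply/fintype.subsetP => m /imsetP[[a b]].
  by rewrite !inE /= => /andP[/andP[_ +] /eqP yb] ->; rewrite yb.
- by rewrite subr_eq0.
- by rewrite leq_mul2l leq_double divT ?orbT.
Qed.

End AdditiveEnergy.

(** * The phase polynomials *)

(** The frequency pair [(k, l)] has phase [k a n ^ d + l a (N - n) ^ d], which is [a] times the
    value at [n] of this polynomial. *)
Definition splitPoly (d : nat) (k l : int) (N : nat) : {poly int} :=
  k *: 'X^d + l *: (N%:Z%:P - 'X) ^+ d.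

Lemma horner_splitPoly (d : nat) (k l : int) (N : nat) (x : int) :
  (splitPoly d k l N).[x] = k * x ^+ d + l * (N%:Z - x) ^+ d.
Proof. by rewrite /splitPoly !hornerE. Qed.

Lemma size_splitPoly_le (d : nat) (k l : int) (N : nat) :
  (size (splitPoly d k l N) <= d.+1)%N.
Proof.
rewrite (leq_trans (size_polyD _ _)) // geq_max; apply/andP; split.
  by rewrite (leq_trans (size_scale_leq _ _)) ?size_polyXn.
rewrite (leq_trans (size_scale_leq _ _)) // (leq_trans (size_poly_exp_leq _ _)) //.
suff : (size (N%:Z%:P - 'X : {poly int})%R <= 2)%N.
  by move: (size _) => [|[|[|]]] // *; lia.
rewrite (leq_trans (size_polyD _ _)) // size_polyN size_polyX geq_max andbT.
by rewrite (leq_trans (size_polyC_leq1 _)).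
Qed.

(* The leading terms cancel when [k = -+ l], so the degree can drop to [d - 1];
   this is where [d >= 3] is needed. *)
Lemma size_splitPoly_gt2 (d : nat) (k l : int) (N : nat) :
  (3 <= d)%N -> (0 < N)%N -> (k, l) != (0, 0) ->
  (2 < size (splitPoly d k l N))%N.
Proof.
move=> d3 N_gt0 kl; rewrite ltnNge; apply/negP => /derivn_poly0.
case: d d3 => [|[|[|d]]] // _; rewrite /splitPoly derivnD !derivnZ derivnXn.
have -> : ((N%:Z%:P - 'X) ^+ d.+3)^`(2) =
    (N%:Z%:P - 'X) ^+ d.+1 *+ d.+2 *+ d.+3 :> {poly int}.
  rewrite derivnS derivn1 deriv_exp derivB derivC derivX sub0r mulN1r.
  by rewrite derivMn derivN deriv_exp derivB derivC derivX sub0r mulN1r !mulNrn !opprK.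
move=> P0; have NE : (N%:Z) ^+ d.+1 != 0 by rewrite expf_neq0; lia.
have eval (a b c e : nat) (x : int) :
    (k *: ('X^e *+ a) + l *: ((N%:Z%:P - 'X) ^+ d.+1 *+ b *+ c)).[x] =
    k * x ^+ e *+ a + l * (N%:Z - x) ^+ d.+1 *+ b *+ c.
  rewrite !(hornerD, hornerZ, hornerMn, hornerXn, horner_exp, hornerN, hornerC, hornerX).
  by rewrite -!mulrnAr.
have {}eval x := esym (eval (d.+3 ^_ 2)%N d.+2 d.+3 (d.+3 - 2)%N x).
rewrite P0 subn2 /= in eval.
(* At [0] the vanishing second derivative reduces to a nonzero multiple of [l], and at [N] to a
   nonzero multiple of [k]. *)
move: kl; have /eqP := eval 0; have /eqP := eval N%:Z; rewrite !horner0.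
rewrite subrr subr0 expr0n /= !(mulr0, mul0rn, addr0, add0r).
rewrite !mulrn_eq0 !mulf_eq0 (negbTE NE) !orbF /= => /eqP -> /eqP ->.
by rewrite eqxx.
Qed.

Lemma splitPoly_bound (d : nat) (k l : int) (N n : nat) : (n <= N)%N ->
  (`|(splitPoly d k l N).[n%:Z]| <= (`|k| + `|l|) * N ^ d)%N.
Proof.
move=> nN; rewrite horner_splitPoly.
have tri (x y : int) : (`|(x + y)%R| <= `|x| + `|y|)%N by lia.
apply: leq_trans (tri _ _) _.
rewrite !abszM !abszX mulnDl leq_add // leq_mul2l leq_expn2r ?orbT //; lia.
Qed.

(** [M] stands for a square root of [N + 1]. Differences of values are [O (M ^ (2d))], so the
    divisor bound with exponent [2d] gives each nonzero one [O (M)] divisors. *)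
Lemma splitPoly_energy (d : nat) (k l : int) : (3 <= d)%N -> (k, l) != (0, 0) ->
  exists C : nat, forall N M : nat, (0 < N)%N -> (N.+1 <= M ^ 2)%N ->
  (additive_energy (splitPoly d k l N) N.+1 <= C * M * N.+1 ^ 2)%N.
Proof.
move=> d3 kl.
have d2_gt0 : (0 < d * 2)%N by lia.
have [C0 C0_gt0 tau] := divisor_bound (d * 2) d2_gt0.
pose B := (`|k| + `|l|)%N; pose C1 := (C0 * B.*2)%N.
have B_gt0 : (0 < B)%N by move: kl; rewrite xpair_eqE /B; lia.
have C1_gt0 : (0 < C1)%N by rewrite muln_gt0 C0_gt0; lia.
exists (d ^ 2 + d * C1.*2)%N => N M N_gt0 NM; pose p := splitPoly d k l N.
have M_gt0 : (0 < M)%N by case: M NM.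
have divT (m n : 'I_N.+1) : p.[m%:Z] != p.[n%:Z] ->
    (size (divisors `|(p.[m%:Z] - p.[n%:Z])%R|) <= C1 * M)%N.
  rewrite -subr_eq0 => mn; rewrite -(leq_exp2r _ _ d2_gt0).
  have vB : (`|(p.[m%:Z] - p.[n%:Z])%R| <= B.*2 * N ^ d)%N.
    have tri (x y : int) : (`|(x - y)%R| <= `|x| + `|y|)%N by lia.
    apply: leq_trans (tri _ _) _.
    by rewrite -addnn mulnDl leq_add // splitPoly_bound // -ltnS.
  apply: leq_trans (tau _ _) _; first by lia.
  apply: (@leq_trans (C1 * M ^ (d * 2))%N).
    rewrite /C1 -mulnA leq_mul2l; apply/orP; right; apply: leq_trans vB _.
    by rewrite leq_mul2l mulnC expnM leq_expn2r ?orbT // ltnW.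
  rewrite expnMn leq_mul2r; apply/orP; right.
  by rewrite -{1}(expn1 C1) leq_pexp2l.
apply: leq_trans (additive_energy_le _ d _ (C1 * M) _ _ divT) _.
- exact: size_splitPoly_gt2.
- exact: size_splitPoly_le.
rewrite expnMn -mulnDl leq_mul2r; apply/orP; right.
by rewrite mulnDl leq_add ?leq_pmulr // -mulnA -doubleMl.
Qed.

(** * Orthogonality of cosines and the fourth moment *)

Definition cos2pi {R : realType} (t : R) : R := cos (pi *+ 2 * t).
Definition sin2pi {R : realType} (t : R) : R := sin (pi *+ 2 * t).

Lemma cos2piB (R : realType) (s t : R) :
  cos2pi (s - t) = cos2pi s * cos2pi t + sin2pi s * sin2pi t.
Proof. by rewrite /cos2pi mulrBr cosB. Qed.

Lemma sin2piDz (R : realType) (t : R) (m : int) : sin2pi (t + m%:~R) = sin2pi t.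
Proof.
have nat_case (n : nat) (s : R) : sin2pi (s + n%:R) = sin2pi s.
  by rewrite /sin2pi mulrDr mulr_natr (periodicn (@sinD2pi R)).
case: m => n; first exact: nat_case.
by rewrite NegzE mulrNz -[in RHS](subrK n.+1%:R t) nat_case.
Qed.

Lemma continuous_cos2piM (R : realType) (c : R) : continuous (fun x : R => cos2pi (x * c)).
Proof.
move=> x; rewrite /cos2pi; apply: (@continuous_cvg _ _ _ _ _ _ (@cos R)).
  exact: continuous_cos.
by apply: cvgM; [exact: cvg_cst|apply: cvgM; [exact: cvg_id|exact: cvg_cst]].
Qed.

(** For [m <> 0] the antiderivative [sin (2 pi m x) / (2 pi m)] vanishes at the integer end
    points. *)
Lemma integral_cos2pi (R : realType) (j m : int) :
  (\int[@lebesgue_measure R]_(x in `[j%:~R, (j + 1)%:~R]) (cos2pi (x * m%:~R))%:E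
    = (m == 0)%:R%:E)%E.
Proof.
have jj1 : j%:~R < (j + 1)%:~R :> R by rewrite ltr_int; lia.
have [->|m0] := eqVneq m 0.
  under eq_integral do rewrite mulr0z mulr0 /cos2pi mulr0 cos0.
  rewrite integral_cst //= mul1e lebesgue_measure_itv /= lte_fin jj1.
  by rewrite -EFinB intrD addrAC subrr add0r.
have pi2m : pi *+ 2 * m%:~R != 0 :> R.
  by rewrite mulf_neq0 ?intr_eq0 // mulrn_eq0 /= gt_eqF ?pi_gt0.
pose F x : R := (pi *+ 2 * m%:~R)^-1 * sin (pi *+ 2 * m%:~R * x).
have dF (x : R) : is_derive x 1 F (cos2pi (x * m%:~R)).
  have -> : F = (pi *+ 2 * m%:~R)^-1 \*: (@sin R \o (pi *+ 2 * m%:~R \*: id)) by [].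
  apply: is_derive_eq; rewrite /GRing.scale /= /cos2pi mulr1.
  by rewrite mulrCA mulVf // mulr1 -[LHS]/(cos (pi *+ 2 * m%:~R * x)) -mulrA (mulrC x).
have cF : continuous F.
  by move=> x; apply: differentiable_continuous; apply/derivable1_diffP; case: (dF x).
rewrite (@continuous_FTC2 _ _ F) //.
- have Fz (z : int) : F z%:~R = 0.
    rewrite /F -mulrA -intrM -/(sin2pi _) -[X in sin2pi X]add0r.
    by rewrite sin2piDz /sin2pi mulr0 sin0 mulr0.
  by rewrite !Fz subee.
- exact/continuous_subspaceT/continuous_cos2piM.
- split; first by move=> x _; case: (dF x).
  + exact/cvg_at_right_filter/cF.
  + exact/cvg_at_left_filter/cF.
- by move=> x _; rewrite derive1E; case: (dF x).
Qed.

(** The real part of a Weyl sum. *)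
Definition cosSum {R : realType} (p : {poly int}) (N : nat) (a : R) : R :=
  \sum_(n < N) cos2pi (a * p.[n%:Z]%:~R).

Section FourthMoment.

Variables (R : realType) (p : {poly int}) (N : nat).
Implicit Types a : R.

Let diff (y : 'I_N * 'I_N) : int := p.[y.1%:Z] - p.[y.2%:Z].

(** The squared modulus of the exponential sum, expanded in real form. *)
Let sum_cos_diff (a : R) :
  \sum_y cos2pi (a * (diff y)%:~R) =
  cosSum p N a ^+ 2 + (\sum_(n < N) sin2pi (a * p.[n%:Z]%:~R)) ^+ 2.
Proof.
rewrite -(pair_bigA _ (fun m n : 'I_N => cos2pi (a * (p.[m%:Z] - p.[n%:Z])%:~R))) /=.
rewrite !expr2 !mulr_suml -big_split; apply: eq_bigr => m _ /=.
rewrite !mulr_sumr -big_split; apply: eq_bigr => n _ /=.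
by rewrite intrB mulrBr cos2piB.
Qed.

Let sum_sin_diff (a : R) : \sum_y sin2pi (a * (diff y)%:~R) = 0.
Proof.
rewrite -(pair_bigA _ (fun m n : 'I_N => sin2pi (a * (p.[m%:Z] - p.[n%:Z])%:~R))) /=.
set S := LHS; suff : S = - S by lra.
rewrite /S {1}exchange_big /= -sumrN; apply: eq_bigr => m _.
rewrite -sumrN; apply: eq_bigr => n _.
by rewrite -opprB intrN mulrN /sin2pi mulrN sinN.
Qed.

Let integral_sum_cos_expr4 (j : int) :
  (\int[@lebesgue_measure R]_(x in `[j%:~R, (j + 1)%:~R])
     ((\sum_y cos2pi (x * (diff y)%:~R)) ^+ 2)%:E = (additive_energy p N)%:R%:E)%E.
Proof.
pose g (y : ('I_N * 'I_N) * ('I_N * 'I_N)) (x : R) :=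
  (cos2pi (x * (diff y.1 - diff y.2)%:~R))%:E.
transitivity (\int[@lebesgue_measure R]_(x in `[j%:~R, (j + 1)%:~R]) \sum_y g y x)%E.
  apply: eq_integral => x _; rewrite sumEFin; congr EFin.
  (* The square of the vanishing sine sum is added, so that products of cosines combine into cosines
     of differences. *)
  rewrite -[LHS]addr0 -[X in _ + X](mulr0 0) -[in X in _ + X](sum_sin_diff x) expr2.
  rewrite -[X in _ = X](pair_bigA _ (fun y z => cos2pi (x * (diff y - diff z)%:~R))) /=.
  rewrite !mulr_suml -big_split; apply: eq_bigr => y _ /=.
  rewrite !mulr_sumr -big_split; apply: eq_bigr => z _ /=.
  by rewrite intrB mulrBr cos2piB.
rewrite integral_sum //; last first.
  move=> y; apply: continuous_compact_integrable; first exact: segment_compact.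
  exact/continuous_subspaceT/continuous_cos2piM.
under eq_bigr do rewrite integral_cos2pi.
rewrite sumEFin -natr_sum; congr (_%:R%:E).
rewrite /additive_energy -sum1dep_card [RHS]big_mkcond; apply: eq_bigr => y _.
by rewrite subr_eq0; case: eqP.
Qed.

Let cos_sum_expr4_le (a : R) :
  cosSum p N a ^+ 4 <= (\sum_y cos2pi (a * (diff y)%:~R)) ^+ 2.
Proof.
rewrite sum_cos_diff -[4%N]/(2 * 2)%N exprM lerXn2r ?nnegrE ?addr_ge0 ?sqr_ge0 //.
by rewrite lerDl sqr_ge0.
Qed.

(** Markov's inequality for the fourth moment over one period. The cover [A] is a superlevel set of
    the majorant [g], whose integral is the additive energy. *)
Lemma measure_large_cos_sum (j : int) (c : R) : 0 < c ->
  exists2 A : set R, measurable A &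
    (`[j%:~R, (j + 1)%:~R] `&` [set a | c <= `|cosSum p N a| ] `<=` A) /\
    (@lebesgue_measure R A <= ((additive_energy p N)%:R / c ^+ 4)%:E)%E.
Proof.
move=> c_gt0; pose g (a : R) : \bar R := ((\sum_y cos2pi (a * (diff y)%:~R)) ^+ 2)%:E.
pose I : set R := `[j%:~R, (j + 1)%:~R]%classic.
have mI : measurable I by exact: measurable_itv.
have mg : measurable_fun I g.
  apply/measurable_EFinP/measurable_funX; apply: measurable_sum => y.
  by apply: measurable_funTS; apply: continuous_measurable_fun; exact: continuous_cos2piM.
exists (I `&` [set x | ((c ^+ 4)%:E <= `|g x|)%E]).
  apply: emeasurable_fun_c_infty => //; exact: measurableT_comp.
split.
  move=> a [aI ca]; split => //=; rewrite lee_fin ger0_norm ?sqr_ge0 //.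
  apply: le_trans (cos_sum_expr4_le a).
  have -> : cosSum p N a ^+ 4 = `|cosSum p N a| ^+ 4.
    by rewrite -normrX ger0_norm // -[4%N]/(2 * 2)%N exprM sqr_ge0.
  by rewrite lerXn2r ?nnegrE // ltW.
have c4 : 0 < c ^+ 4 by rewrite exprn_gt0.
rewrite (EFinM _ (c ^+ 4)^-1) lee_pdivlMr //.
apply: le_trans (_ : \int[@lebesgue_measure R]_(x in I) `|g x| <= _)%E.
  rewrite muleC.
  by apply: (@le_integral_comp_abse _ _ R (@lebesgue_measure R) I mI g (c ^+ 4) id).
rewrite -(integral_sum_cos_expr4 j) le_eqVlt; apply/orP; left; apply/eqP.
by apply: eq_integral => x _; rewrite /g gee0_abs // lee_fin sqr_ge0.
Qed.

End FourthMoment.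

(** * Small cosine sums for almost every [a] *)

Lemma ae_imply (R : realType) (P Q : R -> Prop) : (forall x, P x -> Q x) ->
  {ae @lebesgue_measure R, forall x, P x} -> {ae @lebesgue_measure R, forall x, Q x}.
Proof. by move=> PQ [A [mA A0 PA]]; exists A; split => // x nQ; apply: PA => /PQ. Qed.

Lemma ae_forall_countType (R : realType) (T : countType) (P : T -> R -> Prop) :
  (forall t, {ae @lebesgue_measure R, forall x, P t x}) ->
  {ae @lebesgue_measure R, forall x, forall t, P t x}.
Proof.
move=> aeP.
have : {ae @lebesgue_measure R, forall x, forall n t, unpickle n = Some t -> P t x}.
  apply: ae_foralln => n; case nE: (@unpickle T n) => [t|]; last by apply: aeW.
  by move: (aeP t); apply: ae_imply => x Pt _ [<-].
by apply: ae_imply => x Px t; apply: Px (pickleK t).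
Qed.

Lemma nneseries_inv_sqrt3_lty (R : realType) (K : R) : 0 <= K ->
  (\sum_(n <oo) (K / (n.+1%:R * Num.sqrt n.+1%:R))%:E < +oo)%E.
Proof.
move=> K_ge0.
have term_ge0 n : 0 <= K / (n.+1%:R * Num.sqrt n.+1%:R) :> R.
  by rewrite divr_ge0 // mulr_ge0 ?sqrtr_ge0.
apply: le_lt_trans (ltry (3 * K)).
apply: lime_le; first by apply: is_cvg_nneseries => n _ _; rewrite lee_fin.
apply: nearW => n; rewrite sumEFin lee_fin.
(* [2 K / sqrt (n + 1)] dominates the tail of the series; adding it makes the bound inductive, with
   equality at [n = 0]. *)
suff sum_le : \sum_(0 <= i < n.+1) K / (i.+1%:R * Num.sqrt i.+1%:R) +
    2 * K / Num.sqrt n.+1%:R <= 3 * K.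
  apply: le_trans sum_le; rewrite big_nat_recr //= -addrA lerDl addr_ge0 //.
  by rewrite divr_ge0 ?mulr_ge0 ?sqrtr_ge0.
elim: n => [|n IHn]; first by rewrite big_nat1 sqrtr1; lra.
rewrite big_nat_recr //=; apply: le_trans IHn; rewrite -addrA lerD2l.
set s := Num.sqrt n.+1%:R; set t := Num.sqrt n.+2%:R.
have s_gt0 : 0 < s by rewrite sqrtr_gt0 ltr0n.
have t_gt0 : 0 < t by rewrite sqrtr_gt0 ltr0n.
have tE : n.+2%:R = t ^+ 2 :> R by rewrite sqr_sqrtr ?ler0n.
have t2 : t ^+ 2 = s ^+ 2 + 1 by rewrite -tE sqr_sqrtr ?ler0n // -natr1.
rewrite tE (_ : _ + _ = K * ((1 + 2 * t ^+ 2) / t ^+ 3)); last first.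
  by field; rewrite gt_eqF.
rewrite (_ : 2 * K / s = K * (2 / s)); last by field; rewrite gt_eqF.
apply: ler_wpM2l => //; rewrite ler_pdivrMr ?exprn_gt0 // mulrAC ler_pdivlMr //.
(* This is [(t - s) ^ 2 >= 0] with [s ^ 2 = t ^ 2 - 1]. Multiplying by [1 + 2 t ^ 2] turns the right
   side into [4 t ^ 4 - 1], and dividing by [2 t] gives the claim. *)
have st : 2 * s * t <= 2 * t ^+ 2 - 1 by have := sqr_ge0 (t - s); nra.
rewrite -(ler_pM2r (_ : 0 < 2 * t)) ?mulr_gt0 //.
have : (2 * s * t) * (1 + 2 * t ^+ 2) <= (2 * t ^+ 2 - 1) * (1 + 2 * t ^+ 2).
  by rewrite ler_wpM2r // addr_ge0 // mulr_ge0 // sqr_ge0.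
nra.
Qed.

(* The fourth-moment bound beats [1 / N], so Borel-Cantelli applies. *)
Lemma ae_cosSum_small (R : realType) (d : nat) (k l : int) (eta : R) :
  (3 <= d)%N -> (k, l) != (0, 0) -> 0 < eta ->
  {ae @lebesgue_measure R, forall a : R, \forall N \near \oo,
     `|cosSum (splitPoly d k l N) N.+1 a| < eta * N.+1%:R}.
Proof.
move=> d3 kl eta_gt0; have [C energy] := splitPoly_energy d k l d3 kl.
(* The [2] comes from [M <= 2 sqrt (N + 1)], where [M] is an integer just above [sqrt (N + 1)];
   [eta ^ 4] comes from Markov's inequality at level [eta (N + 1)]. *)
pose K := 2 * C%:R / eta ^+ 4.
have K_ge0 : 0 <= K by apply: divr_ge0; [exact: mulr_ge0|exact/exprn_ge0/ltW].
pose bad N := [set a : R | eta * N.+1%:R <= `|cosSum (splitPoly d k l N) N.+1 a|].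
have bound (j : int) N : exists A : set R, [/\ measurable A,
    (0 < N)%N -> `[j%:~R, (j + 1)%:~R] `&` bad N `<=` A &
    (@lebesgue_measure R A <= (K / (N.+1%:R * Num.sqrt N.+1%:R))%:E)%E].
  case: N => [|N].
    by exists set0; split => //; rewrite measure0 lee_fin divr_ge0 // mulr_ge0 ?sqrtr_ge0.
  set S : R := N.+2%:R; have S_gt0 : 0 < S by rewrite ltr0n.
  have [A mA [subA muA]] := measure_large_cos_sum R (splitPoly d k l N.+1) N.+2 j
    (eta * S) (mulr_gt0 eta_gt0 S_gt0).
  exists A; split => //; apply: le_trans muA _; rewrite lee_fin.
  have r_ge1 : 1 <= Num.sqrt S by rewrite -{1}sqrtr1 ler_sqrt // ler1n.
  have rS : Num.sqrt S ^+ 2 = S by rewrite sqr_sqrtr // ltW.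
  pose M := (Num.truncn (Num.sqrt S)).+1.
  have M_gt : Num.sqrt S < M%:R by exact: truncnS_gt.
  have M_le : M%:R <= 2 * Num.sqrt S.
    have /andP[+ _] := truncn_itv (sqrtr_ge0 S); rewrite /M -natr1; lra.
  have NM : (N.+2 <= M ^ 2)%N.
    by rewrite -(ler_nat R) (natrX _ M) -/S -rS lerXn2r ?nnegrE ?sqrtr_ge0 // ltW.
  have := energy N.+1 M isT NM.
  rewrite -(ler_nat R) (natrM _ (C * M)) (natrM _ C) (natrX _ N.+2) -/S => le1.
  rewrite ler_pdivrMr ?exprn_gt0 ?mulr_gt0 //; apply: le_trans le1 _.
  rewrite (_ : K / _ * _ = C%:R * (2 * Num.sqrt S) * S ^+ 2).
    by rewrite ler_wpM2r ?sqr_ge0 // ler_wpM2l.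
  rewrite /K; move: (Num.sqrt S) r_ge1 rS => r r_ge1 <-.
  by field; rewrite !gt_eqF //; lra.
have ae_j (j : int) : {ae @lebesgue_measure R, forall a : R,
    a \in `[j%:~R, (j + 1)%:~R] -> \forall N \near \oo, ~ bad N a}.
  have [A HA] := choice (bound j).
  (* The exceptional set is the limsup of the covers, null because their measures are summable. *)
  exists (lim_sup_set A); split.
  - apply: bigcap_measurable => // n _; apply: bigcup_measurable => m _.
    by case: (HA m).
  - apply: lim_sup_set_cvg0 => [n|]; first by case: (HA n).
    apply: le_lt_trans (nneseries_inv_sqrt3_lty R K K_ge0).
    by apply: lee_nneseries => [n _ _|n _]; [exact: measure_ge0|case: (HA n)].
  move=> a /= /not_implyP[aj nbad] n _; apply: contrapT => nA; apply: nbad.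
  (* Starting at [n + 1] makes [m] positive, as the covering of [bad m] requires. *)
  exists n.+1 => // m /= nm badm; apply: nA; exists m; first exact: ltnW.
  by have [_ + _] := HA m; apply => //; exact: leq_trans nm.
have := ae_forall_countType _ _ _ ae_j; apply: ae_imply => a /(_ (Num.floor a)).
have aj : a \in `[(Num.floor a)%:~R, (Num.floor a + 1)%:~R].
  by rewrite in_itv /= floor_le ltW // floorD1_gt.
move=> /(_ aj); apply: filterS => N /negP; by rewrite -ltNge.
Qed.

(** * The kernel of even powers of the cosine *)

(** The binomial theorem for [e ^ (i t) + e ^ (- i t)] in real form; the induction step is Pascal's
    rule. *)
Lemma expr_2cos (R : realType) (n : nat) (t : R) :
  (2 * cos t) ^+ n = \sum_(i < n.+1) 'C(n, i)%:R * cos ((n%:R - 2 * i%:R) * t).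
Proof.
elim: n => [|n IHn]; first by rewrite big_ord1 bin0 expr0 mulr0 subr0 mul0r cos0 mulr1.
have prod2 (x : R) : 2 * cos t * cos x = cos (x + t) + cos (x - t).
  by rewrite cosD cosB; ring.
rewrite exprS IHn mulr_sumr.
under eq_bigr => i _ do rewrite mulrCA prod2 mulrDr.
rewrite big_split /= [RHS]big_ord_recl /= bin0.
under [in RHS]eq_bigr => i _ do rewrite /bump /= add1n binS natrD mulrDl.
rewrite big_split /= addrA; congr (_ + _); last first.
  apply: eq_bigr => i _; congr (_ * cos _).
  by rewrite -(@natr1 R n) -(@natr1 R i); ring.
rewrite big_ord_recl [in RHS]big_ord_recr /= (bin_small (ltnSn n)) mul0r addr0 bin0.
congr (1 * cos _ + _); first by rewrite -(@natr1 R n); ring.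
apply: eq_bigr => i _; congr (_ * cos _).
by rewrite /bump /= add1n -(@natr1 R n) -(@natr1 R i); ring.
Qed.

(** The Fourier coefficient of [cos (pi x) ^ (2M)] at frequency [M - i], so that [i = M] gives the
    mean. *)
Definition kernelCoef (R : realType) (M i : nat) : R := 'C(M.*2, i)%:R / 4 ^+ M.

Lemma cos_pi_expansion (R : realType) (M : nat) (x : R) :
  cos (pi * x) ^+ M.*2 =
  \sum_(i < M.*2.+1) kernelCoef R M i * cos2pi ((M%:Z - i%:Z)%:~R * x).
Proof.
have /eqP := expr_2cos R M.*2 (pi * x).
rewrite exprMn -{1}muln2 mulnC exprM -natrX -subr_eq0 => /eqP E.
apply: (@mulfI _ (4 ^+ M)); first by rewrite expf_neq0.
move/subr0_eq: E => ->; rewrite mulr_sumr; apply: eq_bigr => i _.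
rewrite /kernelCoef [RHS]mulrA [4 ^+ M * _]mulrC divfK ?expf_neq0 // /cos2pi.
congr (_ * cos _); rewrite intrB -!pmulrn (_ : M.*2%:R = 2 * M%:R); last by rewrite -mul2n natrM.
by ring.
Qed.

Lemma sum_kernelCoef (R : realType) (M : nat) :
  \sum_(i < M.*2.+1) kernelCoef R M i = 1.
Proof.
have := cos_pi_expansion R M 0; rewrite mulr0 cos0 expr1n => ->.
by apply: eq_bigr => i _; rewrite mulr0 /cos2pi mulr0 cos0 mulr1.
Qed.

(** Induction through [(M + 1) 'C(2M + 2, M + 1) = 2 (2M + 1) 'C(2M, M)]. It shows that the mean of
    the kernel decays only polynomially in [M]. *)
Lemma central_bin_ge (M : nat) : (4 ^ M <= M.*2.+1 * 'C(M.*2, M))%N.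
Proof.
elim: M => [|M IHM] //.
have h1 : (M.+1 * 'C(M.*2.+2, M.+1) = M.*2.+2 * 'C(M.*2.+1, M))%N.
  by rewrite -mul_bin_diag.
have h2 : (M.+1 * 'C(M.*2.+1, M) = M.*2.+1 * 'C(M.*2, M))%N.
  have -> : 'C(M.*2.+1, M) = 'C(M.*2.+1, M.+1).
    by rewrite -bin_sub; [congr 'C(_, _)|]; lia.
  by rewrite -mul_bin_diag.
rewrite doubleS expnS -(leq_pmul2l (ltn0Sn M)) [X in (_ <= X)%N]mulnCA h1.
have : (4 * M.+1 * 4 ^ M <= M.*2.+3 * (2 * (M.+1 * 'C(M.*2.+1, M))))%N.
  rewrite h2; apply: leq_trans (_ : (2 * M.*2.+3) * (M.*2.+1 * 'C(M.*2, M)) <= _)%N; last first.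
    by lia.
  by apply: leq_mul => //; lia.
by move/leq_trans => H; rewrite mulnCA mulnA; apply: H; lia.
Qed.

Lemma kernelCoef_central_ge (R : realType) (M : nat) :
  (M.*2.+1%:R)^-1 <= kernelCoef R M M.
Proof.
rewrite /kernelCoef ler_pdivlMr ?exprn_gt0 // mulrC ler_pdivrMr ?ltr0n //.
by rewrite -natrX -natrM ler_nat mulnC central_bin_ge.
Qed.

Lemma exists_expr_lt_inv_sqr (R : realType) (rho : R) : 0 <= rho < 1 ->
  exists M : nat, rho ^+ M < (M.*2.+1%:R)^-1 ^+ 2.
Proof.
move=> /andP[rho0 rho1]; pose r := 1 - rho; have r_gt0 : 0 < r by rewrite /r; lra.
have bern (m : nat) : rho ^+ m * (m%:R * r) <= 1.
  apply: le_trans (_ : rho ^+ m * (1 + m%:R * r) <= 1).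
    by rewrite ler_wpM2l ?exprn_ge0 //; lra.
  elim: m => [|m IHm]; first by rewrite expr0; lra.
  apply: le_trans IHm; rewrite exprSr -mulrA ler_wpM2l ?exprn_ge0 //.
  rewrite -natr1 (_ : rho = 1 - r); last by rewrite /r; lra.
  have := ler0n R m; have := sqr_ge0 r; nra.
(* Cubing [bern] bounds [rho ^ (3m)] by [1 / (m r) ^ 3], while [(6m + 1) ^ 2 <= 49 m ^ 2]; so
   [m > 49 / r ^ 3] suffices. *)
pose m := (Num.truncn (49 / r ^+ 3)).+1; exists (m * 3)%N.
have m_gt : 49 / r ^+ 3 < m%:R by exact: truncnS_gt.
have m1 : 1 <= m%:R :> R by rewrite ler1n.
have D_gt0 : 0 < (m * 3).*2.+1%:R ^+ 2 :> R by rewrite exprn_gt0 // ltr0n.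
rewrite exprVn -(ltr_pM2r D_gt0) mulVf ?gt_eqF // exprM.
have D_le : (m * 3).*2.+1%:R ^+ 2 <= 49 * m%:R ^+ 2 :> R.
  have : (m * 3).*2.+1%:R <= 7 * m%:R :> R by rewrite -natrM ler_nat; lia.
  have := ler0n R (m * 3).*2.+1; nra.
set q := rho ^+ m; have q_ge0 : 0 <= q by rewrite exprn_ge0.
have [->|q0] := eqVneq q 0; first by rewrite expr0n mul0r.
have q_gt0 : 0 < q by rewrite lt_def q0.
have q3 : 0 < q ^+ 3 * m%:R ^+ 2 by apply: mulr_gt0; apply: exprn_gt0; rewrite ?ltr0n.
apply: le_lt_trans (_ : 49 * (q ^+ 3 * m%:R ^+ 2) < 1).
  by rewrite [X in _ <= X]mulrCA; apply: ler_wpM2l D_le; apply: exprn_ge0.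
apply: lt_le_trans (_ : m%:R * r ^+ 3 * (q ^+ 3 * m%:R ^+ 2) <= 1).
  by rewrite ltr_pM2r // -ltr_pdivrMr ?exprn_gt0.
have -> : m%:R * r ^+ 3 * (q ^+ 3 * m%:R ^+ 2) = (q * (m%:R * r)) ^+ 3 by ring.
by apply: exprn_ile1 (bern m); rewrite mulr_ge0 // mulr_ge0 // ltW.
Qed.

Lemma cos_pi_sqr (R : realType) (x : R) : cos (pi * x) ^+ 2 = (1 + cos2pi x) / 2.
Proof.
have := cos2Dsin2 (pi * x).
rewrite /cos2pi (_ : pi *+ 2 * x = pi * x + pi * x); last by ring.
by rewrite cosD -!expr2; lra.
Qed.

Lemma cos2piDz (R : realType) (t : R) (m : int) : cos2pi (t + m%:~R) = cos2pi t.
Proof.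
have nat_case (n : nat) (s : R) : cos2pi (s + n%:R) = cos2pi s.
  by rewrite /cos2pi mulrDr mulr_natr (periodicn (@cosD2pi R)).
case: m => n; first exact: nat_case.
by rewrite NegzE mulrNz -[in RHS](subrK n.+1%:R t) nat_case.
Qed.

Lemma dist_int_le_half (R : realType) (x : R) : dist_int x <= 2^-1.
Proof.
have f0 : (Num.floor x)%:~R <= x := floor_le x.
have f1 : x < (Num.floor x)%:~R + 1 by have := floorD1_gt x; rewrite intrD.
have [_ dmin] := dist_intP x.
have := dmin (Num.floor x + 1); have := dmin (Num.floor x); rewrite intrD.
by rewrite ger0_norm ?subr_ge0 // ltr0_norm ?subr_lt0 //; lra.
Qed.

Lemma cos2pi_dist_int (R : realType) (x : R) : cos2pi x = cos2pi (dist_int x).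
Proof.
have [[n ->] _] := dist_intP x.
rewrite -{1}(subrK n%:~R x) cos2piDz; case: (ger0P (x - n%:~R)) => // _.
by rewrite /cos2pi mulrN cosN.
Qed.

Lemma cos_pi_sqr_le (R : realType) (eps : R) : 0 < eps ->
  exists2 rho : R, 0 <= rho < 1 &
    forall x, eps < dist_int x -> cos (pi * x) ^+ 2 <= rho.
Proof.
(* The cap [1/2] keeps [2 pi e] in [[0, pi]], where the cosine decreases. *)
move=> eps_gt0; pose e := Num.min eps 2^-1.
have e_gt0 : 0 < e by rewrite lt_min eps_gt0; lra.
have e_le : e <= 2^-1 by rewrite ge_min lexx orbT.
have pi_gt0 := pi_gt0 R.
have in0pi (t : R) : 0 <= t <= 2^-1 -> pi *+ 2 * t \in `[0, pi].
  by move=> ?; rewrite in_itv /=; apply/andP; split; nra.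
have z_in := in0pi 0 ltac:(lra).
have e_in := in0pi e ltac:(lra).
exists ((1 + cos2pi e) / 2).
  have : cos2pi e < cos2pi 0.
    rewrite /cos2pi ltr_cos //; nra.
  have := cos_geN1 (pi *+ 2 * e); rewrite /cos2pi mulr0 cos0; lra.
move=> x eps_lt; rewrite cos_pi_sqr cos2pi_dist_int.
suff : cos2pi (dist_int x) <= cos2pi e by lra.
have d_le := dist_int_le_half R x.
have ed : e <= dist_int x by apply: le_trans (ltW eps_lt); rewrite ge_min lexx.
have d_in := in0pi (dist_int x) ltac:(lra).
by rewrite /cos2pi leNgt ltr_cos // -leNgt ler_wpM2l // mulrn_wge0 // ltW.
Qed.

(** * From small cosine sums to bases of order two *)

Lemma horner_splitPoly_intr (R : realType) (d : nat) (k l : int) (N m : nat) (a : R) :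
  (m <= N)%N -> a * (splitPoly d k l N).[m%:Z]%:~R =
    k%:~R * (a * m%:R ^+ d) + l%:~R * (a * (N - m)%:R ^+ d).
Proof.
move=> mN; rewrite horner_splitPoly intrD !intrM !rmorphXn /= subzn //.
by rewrite -!pmulrn; ring.
Qed.

(** The kernel sum [G] is estimated twice: its zero frequency makes it at least
    [(c M ^ 2 - eta) (N + 1)], whereas it is at most [rho ^ M (N + 1)] if no [m] represents [N]. *)
Lemma basis_order2_of_cosSum_small (R : realType) (d : nat) (a eps : R) : 0 < eps ->
  (forall (k l : int) (eta : R), (k, l) != (0, 0) -> 0 < eta ->
    \forall N \near \oo, `|cosSum (splitPoly d k l N) N.+1 a| < eta * N.+1%:R) ->
  basis_order2 (small_frac_set d a (fun=> eps)).
Proof.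
move=> eps_gt0 small; have [rho rho01 rhoP] := cos_pi_sqr_le R eps eps_gt0.
have [M rhoM] := exists_expr_lt_inv_sqr R rho rho01.
pose c := kernelCoef R M; pose n := M.*2.+1.
have c_ge0 i : 0 <= c i by rewrite divr_ge0 // exprn_ge0.
have rhoM' : rho ^+ M < c M ^+ 2.
  apply: lt_le_trans rhoM _; rewrite lerXn2r ?nnegrE ?invr_ge0 ?ler0n //.
  exact: kernelCoef_central_ge.
(* Half the gap, so that [c M ^ 2 - eta] still exceeds [rho ^ M]. *)
pose eta := (c M ^+ 2 - rho ^+ M) / 2.
have eta_gt0 : 0 < eta by rewrite /eta; lra.
(* A product of two cosines is half a sum of two cosines, one for each sign [b] of the second
   frequency. *)
pose S (i j : 'I_n) (b : bool) N :=
  cosSum (splitPoly d (M%:Z - i%:Z) ((-1) ^+ b * (M%:Z - j%:Z)) N) N.+1 a.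
have allsmall : \forall N \near \oo, forall (i j : 'I_n) (b : bool),
    ~~ ((i == M :> nat) && (j == M :> nat)) -> `|S i j b N| < eta * N.+1%:R.
  apply: filter_forall => i; apply: filter_forall => j; apply: filter_forall => b.
  case: (boolP (_ && _)) => ij; first exact: nearW.
  pose k : int := M%:Z - i%:Z; pose l : int := (-1) ^+ b * (M%:Z - j%:Z).
  have kl : (k, l) != (0, 0).
    apply: contra ij; rewrite /k /l xpair_eqE mulf_eq0 signr_eq0 /= !subr_eq0 !eqz_nat.
    by case/andP => /eqP <- /eqP <-; rewrite !eqxx.
  by have := small _ _ eta kl eta_gt0; apply: filterS => N ? _.
apply: filterS allsmall => N NP.
pose X (m : 'I_N.+1) := a * m%:R ^+ d; pose Y (m : 'I_N.+1) := a * (N - m)%:R ^+ d.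
pose G := \sum_m cos (pi * X m) ^+ M.*2 * cos (pi * Y m) ^+ M.*2.
have expand : G = \sum_(i < n) \sum_(j < n) c i * c j * ((S i j false N + S i j true N) / 2).
  transitivity (\sum_m \sum_(i < n) \sum_(j < n) c i * c j *
      (cos2pi ((M%:Z - i%:Z)%:~R * X m) * cos2pi ((M%:Z - j%:Z)%:~R * Y m))).
    apply: eq_bigr => m _; rewrite !cos_pi_expansion mulr_suml; apply: eq_bigr => i _.
    by rewrite mulr_sumr; apply: eq_bigr => j _; rewrite mulrACA.
  rewrite exchange_big; apply: eq_bigr => i _.
  rewrite exchange_big; apply: eq_bigr => j _.
  rewrite -mulr_sumr -big_split mulr_suml; congr (_ * _); apply: eq_bigr => m _ /=.
  have mN : (m <= N)%N by rewrite -ltnS.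
  rewrite !horner_splitPoly_intr // mul1r mulN1r intrN mulNr.
  by rewrite {3 4}/cos2pi mulrDr mulrBr cosD cosB -/(cos2pi _) -/(cos2pi _); field.
have lower : (c M ^+ 2 - eta) * N.+1%:R <= G.
  have M_n : (M < n)%N by rewrite /n; lia.
  (* Each off-centre average exceeds [- eta (N + 1)]; as the weights [c i c j] sum to [1], the total
     loss is at most [eta (N + 1)]. *)
  apply: le_trans (_ : \sum_(i < n) \sum_(j < n) c i * c j *
     ((((i == M :> nat) && (j == M :> nat))%:R - eta) * N.+1%:R) <= _); last first.
    rewrite expand; apply: ler_sum => i _; apply: ler_sum => j _.
    apply: ler_wpM2l; first exact: mulr_ge0.
    have := NP i j true; have := NP i j false.
    case: (boolP (_ && _)) => [/andP[/eqP iM /eqP jM] _ _|ij /(_ isT) + /(_ isT)].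
      have SE b : S i j b N = N.+1%:R.
        rewrite /S iM jM subrr mulr0 /cosSum.
        under eq_bigr do rewrite horner_splitPoly !mul0r addr0 mulr0 /cos2pi mulr0 cos0.
        by rewrite sumr_const card_ord.
      rewrite !SE /=; have := mulr_ge0 (ltW eta_gt0) (ler0n R N.+1); lra.
    by rewrite !ltr_norml mulr0n sub0r mulNr => /andP[? ?] /andP[? ?]; lra.
  rewrite le_eqVlt; apply/orP; left; apply/eqP.
  have sel : \sum_(i < n) c i * (i == M :> nat)%:R = c M.
    rewrite (bigD1 (Ordinal M_n)) //= eqxx mulr1 big1 ?addr0 // => i.
    by rewrite -val_eqE /= => /negbTE ->; rewrite mulr0.
  transitivity ((\sum_(i < n) c i * (i == M :> nat)%:R) *
      (\sum_(j < n) c j * (j == M :> nat)%:R) * N.+1%:R -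
      (\sum_(i < n) c i) * (\sum_(j < n) c j) * (eta * N.+1%:R)).
    by rewrite sel /c sum_kernelCoef; ring.
  rewrite !mulr_suml -sumrB; apply: eq_bigr => i _.
  rewrite !mulr_sumr !mulr_suml -sumrB; apply: eq_bigr => j _.
  by rewrite -mulnb natrM; ring.
have [m /andP[mX mY]] : exists m : 'I_N.+1, (dist_int (X m) <= eps) && (dist_int (Y m) <= eps).
  apply/existsP; rewrite -[X in is_true X]negbK negb_exists; apply/negP => /forallP far.
  have upper : G <= rho ^+ M * N.+1%:R.
    rewrite mulr_natr -[N.+1 in X in _ <= X]card_ord -sumr_const; apply: ler_sum => m _.
    have cos_le1 (t : R) : cos t ^+ M.*2 <= 1.
      by rewrite -mul2n exprM exprn_ile1 ?sqr_ge0 // -(cos2Dsin2 t) lerDl sqr_ge0.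
    have cos_ge0 (t : R) : 0 <= cos t ^+ M.*2.
      by rewrite -mul2n exprM exprn_ge0 ?sqr_ge0.
    have cos_rho (t : R) : eps < dist_int t -> cos (pi * t) ^+ M.*2 <= rho ^+ M.
      move=> /rhoP ?; rewrite -mul2n exprM lerXn2r ?nnegrE ?sqr_ge0 //.
      by case/andP: rho01.
    have := far m; rewrite negb_and -!ltNge => /orP[] /cos_rho.
      by apply: le_trans; rewrite ler_piMr.
    by apply: le_trans; rewrite ler_piMl.
  have : 0 < N.+1%:R :> R by rewrite ltr0n.
  have := le_trans lower upper; rewrite ler_pM2r ?ltr0n // /eta; lra.
exists (m : nat) => //; exists (N - m)%N => //.
by rewrite subnKC // -ltnS.
Qed.

(** A diagonal choice: the tolerance at [n] is [1 / (K n + 1)], with [K n] the largest [k <= n]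
    whose threshold [L k] is at most [n]. As [K] is nondecreasing, the tolerance at a summand of [N]
    is no smaller than the one at [N]. *)
Lemma exists_eps_of_constant (R : realType) (d : nat) (a : R) :
  (forall eps : R, 0 < eps -> basis_order2 (small_frac_set d a (fun=> eps))) ->
  exists eps_a : nat -> R,
    [/\ forall n, 0 < eps_a n,
        eps_a n @[n --> \oo] --> (0 : R)
      & forall eps : nat -> R, (forall n, eps_a n <= eps n) ->
          basis_order2 (small_frac_set d a eps)].
Proof.
move=> basis.
have bound (k : nat) : exists L : nat, forall N, (L <= N)%N ->
    sumset2 (small_frac_set d a (fun=> k.+1%:R^-1)) N.
  have [|L _ LP] := basis k.+1%:R^-1; first by rewrite invr_gt0 ltr0n.
  by exists L => N; exact: LP.
have [L LP] := choice bound.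
(* The maximum is [0] by default when no [k] qualifies, hence the condition [L 0 <= n] in
   [K_att]. *)
pose K n := (\max_(k < n.+1 | (L k <= n)%N) k)%N.
have K_ge k n : (k <= n)%N -> (L k <= n)%N -> (k <= K n)%N.
  by move=> kn Lk;
    exact: (@leq_bigmax_cond _ (fun i : 'I_n.+1 => (L i <= n)%N) _
      (Ordinal (kn : (k < n.+1)%N))).
have K_mono m n : (m <= n)%N -> (K m <= K n)%N.
  move=> mn; apply/bigmax_leqP => -[k km] /= Lk.
  by apply: K_ge; [exact: leq_trans mn|exact: leq_trans mn].
have K_att n : (L 0%N <= n)%N -> (L (K n) <= n)%N.
  move=> L0; have [|k Lk kE] := @eq_bigmax_cond _ (fun k : 'I_n.+1 => (L k <= n)%N)
    (@nat_of_ord n.+1).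
    by apply/card_gt0P; exists ord0.
  by rewrite (_ : K n = k); [exact: Lk|exact: kE].
exists (fun n => (K n).+1%:R^-1); split.
- by move=> n; rewrite invr_gt0 ltr0n.
- apply/cvgrPdist_lt => e e_gt0.
  pose k := Num.truncn e^-1; near=> n.
  have Kn : (k <= K n)%N by apply: K_ge; near: n; exact: nbhs_infty_ge.
  rewrite sub0r normrN ger0_norm ?invr_ge0 ?ler0n // invf_plt ?posrE ?ltr0n //.
  apply: lt_le_trans (truncnS_gt _) _; by rewrite ler_nat ltnS.
- move=> eps le_eps; exists (L 0%N) => // N /= L0.
  have [n1 A1 [n2 A2 nE]] := LP (K N) N (K_att N L0).
  have lift n : (n <= N)%N -> small_frac_set d a (fun=> (K N).+1%:R^-1) n ->
      small_frac_set d a eps n.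
    move=> nN /= /le_trans; apply; apply: le_trans (le_eps n).
    by rewrite lef_pV2 ?posrE ?ltr0n // ler_nat ltnS K_mono.
  exists n1; first by apply: lift A1; rewrite -nE leq_addr.
  by exists n2 => //; apply: lift A2; rewrite -nE leq_addl.
Unshelve. all: by end_near.
Qed.

(** * Parity obstruction and Baire category *)

(** The cofactor [K] is odd because [x ^ d - (- y) ^ d] has the parity of [x + y]. *)
Lemma subX_oppX_odd (d x y : nat) : (0 < d)%N -> odd (x + y) ->
  exists K : int, [/\ x%:Z ^+ d - (- y%:Z) ^+ d = (x + y)%N%:Z * K & odd `|K|%N].
Proof.
move=> d_gt0 xy_odd; have := subrXX x%:Z (- y%:Z) d; rewrite opprK => E.
exists (\sum_(i < d) x%:Z ^+ (d.-1 - i) * (- y%:Z) ^+ i); split; first by rewrite E PoszD.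
have : odd `|(x%:Z ^+ d - (- y%:Z) ^+ d)|%N.
  rewrite exprNn; have xd : odd (x ^ d) = odd x by rewrite oddX gtn_eqF.
  have yd : odd (y ^ d) = odd y by rewrite oddX gtn_eqF.
  have pX (z : nat) : z%:Z ^+ d = (z ^ d)%N%:Z.
    by elim: (d) => // e IHe; rewrite exprS expnS IHe PoszM.
  rewrite !pX -signr_odd; move: xy_odd; rewrite oddD -xd -yd.
  by case: (odd d); rewrite ?expr0 ?expr1 ?mul1r ?mulN1r ?opprK; lia.
by rewrite E -PoszD abszM /= oddM xy_odd.
Qed.

(** If [N = x + y] were a representation, with [m] and [n] the integers nearest to [a x ^ d] and
    [a y ^ d], then [z = b K - 2 (m - s n)] would be odd, hence nonzero. But [z] is twice a signed
    sum of three errors of size at most [1/8], so [|z| <= 3/4]. *)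
Lemma not_sumset2_near_half (R : realType) (d N : nat) (b : int) (a : R) :
  (0 < d)%N -> odd N -> odd `|b|%N ->
  `|a - b%:~R / (2 * N%:R)| < (16 * N%:R ^+ d)^-1 ->
  ~ sumset2 (small_frac_set d a (fun=> 8^-1)) N.
Proof.
move=> d_gt0 N_odd b_odd a_near [x Ax [y Ay xyN]].
have N_gt0 : (0 < N)%N by case: (N) N_odd.
have NR_gt0 : 0 < N%:R :> R by rewrite ltr0n.
rewrite /small_frac_set /= in Ax Ay.
have [[m mE] _] := dist_intP (a * x%:R ^+ d); rewrite mE in Ax.
have [[n nE] _] := dist_intP (a * y%:R ^+ d); rewrite nE in Ay.
have [K [KE K_odd]] := subX_oppX_odd d x y d_gt0 ltac:(by rewrite xyN).
pose s : int := (-1) ^+ d.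
have KR : x%:R ^+ d - s%:~R * y%:R ^+ d = N%:R * K%:~R :> R.
  rewrite xyN exprNn in KE; have := congr1 (fun z : int => z%:~R : R) KE.
  by rewrite /s intrB !intrM !rmorphXn.
pose th := a - b%:~R / (2 * N%:R).
pose z := b * K - 2 * (m - s * n).
have z_odd : z != 0.
  apply/eqP => z0; have : odd `|(b * K)%R|%N by rewrite abszM oddM b_odd.
  by rewrite (_ : b * K = 2 * (m - s * n)) ?abszM ?oddM //; rewrite /z in z0; lia.
have zR : z%:~R = 2 * ((a * x%:R ^+ d - m%:~R) - s%:~R * (a * y%:R ^+ d - n%:~R)
    - th * (x%:R ^+ d - s%:~R * y%:R ^+ d)) :> R.
  have XE : x%:R ^+ d = N%:R * K%:~R + s%:~R * y%:R ^+ d :> R by rewrite -KR subrK.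
  rewrite XE /z /th !(intrD, intrN, intrM, intrB); field; rewrite gt_eqF //.
have z_ge1 : 1 <= `|z%:~R| :> R.
  by rewrite -intr_norm ler1z; lia.
have norm_s : `|s%:~R| = 1 :> R by rewrite /s rmorphXn /= normrX normrN1 expr1n.
have pow_le (t : nat) : (t <= N)%N -> t%:R ^+ d <= N%:R ^+ d :> R.
  by move=> tN; rewrite lerXn2r ?nnegrE ?ler0n // ler_nat.
have XY_le : `|x%:R ^+ d - s%:~R * y%:R ^+ d| <= 2 * N%:R ^+ d :> R.
  apply: le_trans (ler_normB _ _) _; rewrite normrM norm_s mul1r.
  rewrite !ger0_norm ?exprn_ge0 // mulr2n mulrDl mul1r lerD // pow_le // -xyN.
    exact: leq_addr.
  exact: leq_addl.
have th_le : `|th * (x%:R ^+ d - s%:~R * y%:R ^+ d)| <= 8^-1.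
  rewrite normrM; apply: le_trans (ler_pM _ _ (ltW a_near) XY_le) _ => //.
  have Nd : N%:R ^+ d != 0 :> R by rewrite expf_neq0 // gt_eqF.
  by rewrite le_eqVlt; apply/orP; left; apply/eqP; field.
have sAy : `|s%:~R * (a * y%:R ^+ d - n%:~R)| <= 8^-1 by rewrite normrM norm_s mul1r.
move: z_ge1; rewrite zR normrM (ger0_norm (ler0n R 2)).
have := ler_normB (a * x%:R ^+ d - m%:~R - s%:~R * (a * y%:R ^+ d - n%:~R))
  (th * (x%:R ^+ d - s%:~R * y%:R ^+ d)).
have := ler_normB (a * x%:R ^+ d - m%:~R) (s%:~R * (a * y%:R ^+ d - n%:~R)).
lra.
Qed.

(** A point lying in these sets for every [n] has such approximations with [N] arbitrarily large. *)
Definition nearHalf (R : realType) (d n : nat) : set R :=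
  [set a | exists N : nat, exists b : int, [/\ (n <= N)%N, odd N, odd `|b|%N &
    `|a - b%:~R / (2 * N%:R)| < (16 * N%:R ^+ d)^-1]].

Lemma open_nearHalf (R : realType) (d n : nat) : open (nearHalf R d n).
Proof.
rewrite openE => a [N [b [nN N_odd b_odd ab]]].
pose c : R := b%:~R / (2 * N%:R); pose r : R := (16 * N%:R ^+ d)^-1.
have : nbhs a (ball c r).
  apply: open_nbhs_nbhs; split; last by rewrite -ball_normE /= distrC.
  by apply: ball_open; exact: le_lt_trans ab.
by apply: filterS => x; rewrite -ball_normE /= distrC => xb; exists N, b.
Qed.

Lemma nearHalf_meets (R : realType) (d n : nat) (O : set R) :
  open O -> O !=set0 -> O `&` nearHalf R d n !=set0.
Proof.
move=> Oo [x Ox]; have /nbhs_ballP[e /= e_gt0 xeO] : nbhs x O by exact: open_nbhs_nbhs.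
have [N [nN eN N_odd]] : exists N, [/\ (n <= N)%N, e^-1 < N%:R & odd N].
  have eT := truncnS_gt e^-1; move: (Num.truncn _) eT => t eT.
  exists (n + t).*2.+1; split; [lia| |by rewrite /= odd_double].
  by apply: lt_le_trans eT _; rewrite ler_nat; lia.
have N_gt0 : 0 < N%:R :> R by rewrite ltr0n; case: (N) N_odd.
(* [b / 2N] is the midpoint of the interval from [f / N] to [(f + 1) / N], which contains [x]. *)
pose f := Num.floor (N%:R * x); pose b := 2 * f + 1.
exists (b%:~R / (2 * N%:R)); split; last first.
  exists N, b; split => //; first by rewrite /b; lia.
  by rewrite subrr normr0 invr_gt0 mulr_gt0 // exprn_gt0.
apply: xeO; rewrite -ball_normE /=.
have f0 : f%:~R <= N%:R * x := floor_le _.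
have f1 : N%:R * x < f%:~R + 1 by have := floorD1_gt (N%:R * x); rewrite intrD.
have bE : b%:~R = 2 * f%:~R + 1 :> R by rewrite /b intrD intrM.
apply: le_lt_trans (_ : N%:R^-1 < e); last by rewrite invf_plt ?posrE.
rewrite bE (_ : x - _ = (N%:R * x - f%:~R - 2^-1) / N%:R); last by field; rewrite gt_eqF.
rewrite normrM [`|N%:R^-1|]ger0_norm ?invr_ge0 ?ler0n // ler_piMl ?invr_ge0 ?ler0n //.
by rewrite ler_norml; lra.
Qed.

(** If [S] were countable, an injection [g] would number its union with the rationals. [F i] deletes
    the point numbered [i], so a point of every [F i] is irrational and outside [S]; yet its
    approximations put it in [S]. *)
Lemma uncountable_not_basis (R : realType) (d : nat) : (0 < d)%N ->
  ~ countable [set a : R | irrational a /\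
      ~ basis_order2 (small_frac_set d a (fun=> 8^-1))].
Proof.
move=> d_gt0; set S := [set a : R | _] => cS.
have cT : countable (S `|` @rational R).
  have -> : S `|` @rational R = \bigcup_(c in [set: bool]) (if c then S else @rational R).
    rewrite eqEsubset; split => [x [?|?]|x [[] _ ?]]; by [exists true|exists false|left|right].
  apply: bigcup_countable => // -[] _ //.
  exact: sub_countable (card_image_le _ _) _.
have /countable_injP[g ginj] := cT.
pose F i : set R := nearHalf R d i `&` ~` [set x | (S `|` @rational R) x /\ g x = i].
have F_open_dense i : open (F i) /\ dense (F i).
  have [y Ey] : exists y, [set x | (S `|` @rational R) x /\ g x = i] `<=` [set y].
    have [[y [Ty gy]]|none] := pselect (exists y, (S `|` @rational R) y /\ g y = i).
      by exists y => x [Tx gx]; apply: ginj; rewrite ?inE // gx gy.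
    by exists 0 => x Tx; exfalso; apply: none; exists x.
  have opC : open (~` [set x | (S `|` @rational R) x /\ g x = i]).
    by rewrite openC; case: (subset_set1 Ey) => ->; [exact: closed0|exact: closed_eq].
  split; first by apply: openI opC; exact: open_nearHalf.
  move=> O [x Ox] Oo; have [z [[Oz zy] nz]] : (O `&` ~` [set y]) `&` nearHalf R d i !=set0.
    apply: nearHalf_meets; first by apply: openI Oo _; rewrite openC; exact: closed_eq.
    (* Deleting [y] leaves the open set nonempty: if [x = y], move away by half the radius [e]. *)
    have [xy|xy] := pselect (x = y); last by exists x.
    have /nbhs_ballP[e /= e_gt0 xeO] : nbhs x O by exact: open_nbhs_nbhs.
    exists (x + e / 2); split.
      apply: xeO; rewrite -ball_normE /= opprD addrA subrr sub0r normrN ger0_norm; lra.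
    by rewrite -xy /=; lra.
  by exists z; split => //; split => // /Ey.
have [a [_ aF]] := Baire F_open_dense (ex_intro [set: R] (0 : R) I) openT.
have aT : ~ (S `|` @rational R) a.
  by move=> Ta; have [_ /= naF] := aF (g a) I; apply: naF.
apply: aT; have [|a_irr] := pselect (rational a); first by right.
left; split => // -[L _ basisL].
have [[N [b [LN N_odd b_odd ab]]] _] := aF L I.
exact: not_sumset2_near_half d_gt0 N_odd b_odd ab (basisL N LN).
Qed.

Theorem theoremB (R : realType) (d : nat) (hd : (3 <= d)%N) :
  {ae (@lebesgue_measure R), forall alpha : R, irrational alpha ->
    exists eps_alpha : nat -> R,
      [/\ forall n, 0 < eps_alpha n,
          eps_alpha n @[n --> \oo] --> (0 : R)
        & forall eps : nat -> R,
            (forall n, 0 < eps n) ->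
            (forall n, eps_alpha n <= eps n) ->
            basis_order2 (small_frac_set d alpha eps)]}
  /\
  exists2 eps0 : R, 0 < eps0 &
    ~ countable [set alpha : R | irrational alpha /\
                   ~ basis_order2 (small_frac_set d alpha (fun=> eps0))].
Proof.
split; last first.
  exists 8^-1; first by rewrite invr_gt0.
  by apply: uncountable_not_basis; exact: leq_trans hd.
(* Restricting [eta] to the values [1 / (m + 1)] leaves countably many conditions, so a single null
   set serves all [k], [l] and [eta]. *)
have small (t : int * int * nat) : {ae @lebesgue_measure R, forall a : R, t.1 != (0, 0) ->
    \forall N \near \oo,
      `|cosSum (splitPoly d t.1.1 t.1.2 N) N.+1 a| < t.2.+1%:R^-1 * N.+1%:R}.
  case: t => [[k l] m] /=; have [kl0|kl] := eqVneq (k, l) (0, 0).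
    by apply: aeW => a /negP[]; apply/eqP.
  have m_gt0 : 0 < m.+1%:R^-1 :> R by rewrite invr_gt0 ltr0n.
  by have := ae_cosSum_small R d k l _ hd kl m_gt0; apply: ae_imply.
have := ae_forall_countType R _ _ small; apply: ae_imply => a a_small _.
have [|eps_a [eps_gt0 eps_cvg basis]] := exists_eps_of_constant R d a; last first.
  by exists eps_a; split => // eps _; exact: basis.
move=> eps eps_gt0; apply: basis_order2_of_cosSum_small => // k l eta kl eta_gt0.
have := a_small (k, l, Num.truncn eta^-1) kl; apply: filterS => N /= /lt_le_trans; apply.
rewrite ler_pM2r ?ltr0n // -[leRHS]invrK lef_pV2 ?posrE ?ltr0n ?invr_gt0 //.
by rewrite ltW // truncnS_gt.
Qed.
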